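(* There exists an absolute constant $c>0$ such that the following holds. Let $A\subset\mathbb{Z}$ be a finite nonempty set with diameter $D=\max(A)-\min(A)$, let $T\subset\mathbb{Z}$ be such that $A\oplus T=\mathbb{Z}$ is a tiling, and suppose that the least period $M$ of $T$ has the same prime factors as $|A|$. (If $A$ tiles $\mathbb{Z}$, then such a tiling always exists.) Then $$\mathcal{P}(A)\leq M\leq \exp\left(c\,\frac{(\log D)^2}{\log\log D}\right).$$
   Context: For a finite nonempty set $A\subset\mathbb{Z}$ and a set $T\subset\mathbb{Z}$, the notation $A\oplus T=\mathbb{Z}$ (a tiling of $\mathbb{Z}$ by translates of $A$) means that every integer $n$ has a unique representation $n=a+t$ with $a\in A$ and $t\in T$; $A$ tiles $\mathbb{Z}$ if such a $T$ exists. A set $T\subset \mathbb{Z}$ is $N$-periodic, for a positive integer $N$, if $T+N=T$; the least period of $T$ is the smallest positive integer $N$ such that $T$ is $N$-periodic (if $A$ is finite and $A\oplus T=\mathbb{Z}$, then $T$ is always periodic, by a theorem of Newman). ''$M$ has the same prime factors as $|A|$'' means that the set of primes dividing $M$ equals the set of primes dividing $|A|$ (multiplicities may differ). If $A$ tiles $\mathbb{Z}$, the minimal tiling period $\mathcal{P}(A)$ is the smallest positive integer $N$ such that there exists an $N$-periodic set $T'\subset\mathbb{Z}$ with $A\oplus T'=\mathbb{Z}$. Here $\log$ is the natural logarithm.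
   Formalization: The upper bound on M is stated only for D ≥ 3: log log D is undefined for D = 0, 1, and for D = 2 it is negative, so the bound is below 1 and fails (A = {0,2}, M = 4); P(A) ≤ M is stated for all D. *)

(* Defs.v *)
From mathcomp Require Import all_boot all_order all_algebra finmap.
From mathcomp Require Import mathcomp_extra unstable boolp classical_sets.

Set Implicit Arguments.
Unset Strict Implicit.
Unset Printing Implicit Defensive.

Import Order.TTheory GRing.Theory Num.Theory.

Local Open Scope classical_set_scope.
Local Open Scope ring_scope.

Definition tiling (A : {fset int}) (T : set int) : Prop :=
  forall n : int, exists! p : int * int,
    [/\ p.1 \in A, T p.2 & n = p.1 + p.2].

Definition tiles (A : {fset int}) : Prop := exists T : set int, tiling A T.

Definition periodic (T : set int) (N : nat) : Prop :=
  (0 < N)%N /\ [set t + N%:Z | t in T] = T.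

Definition is_least (S : set nat) (n : nat) : Prop :=
  S n /\ forall m : nat, S m -> (n <= m)%N.

Definition is_least_period (T : set int) (M : nat) : Prop :=
  is_least (periodic T) M.

Definition tiling_periods (A : {fset int}) : set nat :=
  [set N | exists T : set int, periodic T N /\ tiling A T].

(* The value is 0 when A has no periodic tiling; see [min_tiling_periodP]. *)
Definition min_tiling_period (A : {fset int}) : nat :=
  xget 0%N [set N | is_least (tiling_periods A) N].

Definition same_prime_factors (m n : nat) : Prop :=
  forall p : nat, prime p -> (p %| m)%N = (p %| n)%N.

(* The iterated max (min) is seeded with an element of A, so that it is the
   maximum (minimum) of A when A is nonempty; both are 0 when A is empty. *)
Definition fset_max (A : {fset int}) : int :=
  \big[Order.max/head 0 (enum_fset A)]_(a <- enum_fset A) a.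

Definition fset_min (A : {fset int}) : int :=
  \big[Order.min/head 0 (enum_fset A)]_(a <- enum_fset A) a.

Definition diameter (A : {fset int}) : int := fset_max A - fset_min A.

Lemma min_tiling_periodP (A : {fset int}) :
  (exists N, tiling_periods A N) ->
  is_least (tiling_periods A) (min_tiling_period A).
Proof.
move=> exN; rewrite /min_tiling_period; case: xgetP => [x _ //|noleast].
have exb : exists N, `[< tiling_periods A N >].
  by case: exN => N AN; exists N; apply/asboolP.
case: (ex_minnP exb) => m /asboolP Am minm.
by case: (noleast m); split=> // n An; apply/minm/asboolP.
Qed.

Lemma fset_maxP (A : {fset int}) : A != fset0 ->
  fset_max A \in A /\ forall a, a \in A -> a <= fset_max A.
Proof.
have seqP (s : seq int) : s != [::] ->
    let m := \big[Order.max/head 0 s]_(a <- s) a in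
    m \in s /\ forall a, a \in s -> a <= m.
  move=> s0 /=; split=> [|a aA]; last exact: (le_bigmax_seq _ a).
  rewrite big_seq; elim/big_ind: _ => // [|x y xs ys].
    by case: s s0 => //= b s _; rewrite mem_head.
  by rewrite maxEle; case: ifP.
by rewrite -cardfs_eq0 size_eq0 => /seqP.
Qed.

Lemma fset_minP (A : {fset int}) : A != fset0 ->
  fset_min A \in A /\ forall a, a \in A -> fset_min A <= a.
Proof.
have minP (x0 : int) (s : seq int) a : a \in s ->
    \big[Order.min/x0]_(b <- s) b <= a.
  elim: s => // b s IHs; rewrite big_cons ge_min inE.
  by case/predU1P=> [->|/IHs ->]; rewrite ?lexx ?orbT.
have seqP (s : seq int) : s != [::] ->
    let m := \big[Order.min/head 0 s]_(a <- s) a in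
    m \in s /\ forall a, a \in s -> m <= a.
  move=> s0 /=; split=> [|a]; last exact: minP.
  rewrite big_seq; elim/big_ind: _ => // [|x y xs ys].
    by case: s s0 => //= b s _; rewrite mem_head.
  by rewrite minEle; case: ifP.
by rewrite -cardfs_eq0 size_eq0 => /seqP.
Qed.

(* Main.v *)
Require Import Defs.
From mathcomp Require Import all_boot all_order all_algebra finmap.
From mathcomp Require Import all_field zify ring lra.
From mathcomp Require Import boolp classical_sets reals sequences exp.

Import Order.TTheory GRing.Theory Num.Theory.

Local Open Scope ring_scope.

Set Implicit Arguments.
Unset Strict Implicit.
Unset Printing Implicit Defensive.

(** Let polynomials act on functions on the integers, the variable acting as
    the shift.  Reversing and translating A turns it into a polynomial P of
    degree D = diameter A, and A tiles with T exactly when P sends the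
    indicator function f of T to the constant function 1.

    Upper bound on M.  Let p be a prime dividing M.  Since M / p is not a
    period of T, the function g = ('X^(M/p) - 1) f is nonzero.  It is killed by
    P, as P f is constant, and by Q = ('X^M - 1) / ('X^(M/p) - 1), as f is
    M-periodic.  Hence P and Q are not coprime, and they share a complex root z
    (tiling_common_root).  The order m of z divides M but not M / p, so it has
    the same p-part as M; and the minimal polynomial of z over the rationals,
    which is cyclotomic of degree totient m, divides P.  Thus
    totient (p ^ logn p M) <= totient m <= D, and p ^ logn p M <= 2 * D
    (period_prime_part_leq).  Multiplying over the k primes that divide M, we
    get M <= (2 * D) ^ k.  These k primes are the prime divisors of #|A|, so
    k! and 2 ^ k are at most #|A| <= D + 1, which makes k at most a constant
    times ln D / ln (ln D) (size_mul_lnln_le).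

    Existence of T.  A tiling set is determined by any window of length D, so
    by the pigeonhole principle it is periodic (tiling_periodic).  If q is a
    prime not dividing #|A|, then P ^ q = P('X^q) modulo q and
    P ^ q f = #|A| ^ (q - 1), so every integer can be written q * a + t with a
    in A and t in T; averaging over a period of T shows that it can be so
    written in only one way (tiling_dilate).  Consequently, when q divides the
    period M of T, the set of the t with q * t in T is an (M / q)-periodic set
    which A tiles with.  A tiling of the smallest possible period therefore has
    no such prime q, while #|A| divides its period. *)

(** * Polynomials acting on functions of an integer variable *)

(** The action of P on f: the variable acts as the shift of f by 1. *)
Definition polyact (k : comNzRingType) (P : {poly k}) (f : int -> k)
    (n : int) : k :=
  \sum_(i < size P) P`_i * f (n + i%:Z).

Section PolyAct.
Variable k : comNzRingType.
Implicit Types (P Q : {poly k}) (f g : int -> k) (n : int).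

Lemma polyact_wide P f n m : (size P <= m)%N ->
  polyact P f n = \sum_(i < m) P`_i * f (n + i%:Z).
Proof.
move=> lePm; rewrite /polyact.
rewrite (big_ord_widen _ (fun i => P`_i * f (n + i%:Z)) lePm).
rewrite big_mkcond; apply: eq_bigr => i _; case: ltnP => // lePi.
by rewrite nth_default // mul0r.
Qed.

Lemma polyactD P Q f n : polyact (P + Q) f n = polyact P f n + polyact Q f n.
Proof.
have le := size_polyD P Q; set m := maxn _ _ in le.
rewrite (polyact_wide _ _ le) (@polyact_wide P _ _ m) ?leq_maxl //.
rewrite (@polyact_wide Q _ _ m) ?leq_maxr // -big_split; apply: eq_bigr => i _.
by rewrite coefD mulrDl.
Qed.

Lemma polyactZ c P f n : polyact (c *: P) f n = c * polyact P f n.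
Proof.
rewrite (polyact_wide _ _ (size_scale_leq c P)) mulr_sumr.
by apply: eq_bigr => i _; rewrite coefZ mulrA.
Qed.

Lemma polyact0 f n : polyact 0 f n = 0.
Proof. by rewrite /polyact size_poly0 big_ord0. Qed.

Lemma polyact_sum (I : Type) (s : seq I) (F : I -> {poly k}) f n :
  polyact (\sum_(i <- s) F i) f n = \sum_(i <- s) polyact (F i) f n.
Proof.
apply: (big_morph (fun P => polyact P f n)) => [P Q|]; first exact: polyactD.
exact: polyact0.
Qed.

Lemma polyactXnM m P f n : polyact (P * 'X^m) f n = polyact P f (n + m%:Z).
Proof.
have le : (size (P * 'X^m)%R <= m + size P)%N.
  by apply: leq_trans (size_polyMleq _ _) _; rewrite size_polyXn; lia.
rewrite (polyact_wide _ _ le) big_split_ord /= big1 ?add0r => [|i _]; last first.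
  by rewrite coefMXn ltn_ord mul0r.
apply: eq_bigr => i _; rewrite coefMXn ifF; last by lia.
by rewrite addKn PoszD addrA.
Qed.

Lemma polyact1 f n : polyact 1 f n = f n.
Proof. by rewrite /polyact size_poly1 big_ord1 coef1 mul1r addr0. Qed.

Lemma polyactXn m f n : polyact 'X^m f n = f (n + m%:Z).
Proof. by rewrite -['X^m]mul1r polyactXnM polyact1. Qed.

Lemma polyactM P Q f n : polyact (P * Q) f n = polyact P (polyact Q f) n.
Proof.
rewrite -{1}[P]coefK poly_def mulr_suml polyact_sum; apply: eq_bigr => i _.
by rewrite -scalerAl polyactZ mulrC -polyactXnM mulrC [_ * Q]mulrC.
Qed.

Lemma polyact_cst P c n : polyact P (fun=> c) n = P.[1] * c.
Proof.
rewrite horner_coef /polyact mulr_suml.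
by apply: eq_bigr => i _; rewrite expr1n mulr1.
Qed.

Lemma eq_polyact P f g : f =1 g -> polyact P f =1 polyact P g.
Proof. by move=> fg n; apply: eq_bigr => i _; rewrite fg. Qed.

Lemma polyactXnB1 m f n : polyact ('X^m - 1) f n = f (n + m%:Z) - f n.
Proof. by rewrite -scaleN1r polyactD polyactZ polyactXn polyact1 mulN1r. Qed.
End PolyAct.

(** * Tilings and periods in terms of indicator functions *)

(** A tiles with T if and only if the translates of T by the elements of A cover
    each integer exactly once. *)
Lemma tilingP (A : {fset int}) (T : set int) :
  tiling A T <->
  forall n : int, (\sum_(a <- enum_fset A) `[< T (n - a)%R >] = 1)%N.
Proof.
split=> [tAT n|hit1 n].
  have [[a t] [[/= Aa Tt def_n] uniq_at]] := tAT n.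
  have Tna : T (n - a) by rewrite [n - a](_ : _ = t) //; lia.
  rewrite (bigD1_seq a) ?fset_uniq //= asboolT // big_seq_cond big1 // => b.
  case/andP=> Ab neq_ba.
  apply/eqP; rewrite eqb0; apply/asboolPn => Tb.
  have [ab _] : (a, t) = (b, n - b) by apply: uniq_at; split=> //=; lia.
  by rewrite ab eqxx in neq_ba.
have [/hasP[a Aa /asboolP Ta]|/hasPn noA] :=
  boolP (has (fun a => `[< T (n - a) >]) (enum_fset A)); last first.
  by have := hit1 n; rewrite big_seq big1 // => a /noA /negbTE ->.
exists (a, n - a); split=> [|[b t] [/= Ab Tt def_n]]; first by split=> //=; lia.
have {Tt} Tb : T (n - b) by rewrite [n - b](_ : _ = t) //; lia.
have [eq_ba|neq_ba] := eqVneq b a; first by congr (_, _); lia.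
have := hit1 n; rewrite (bigD1_seq a) ?fset_uniq //= asboolT //.
rewrite -big_filter (bigD1_seq b) ?filter_uniq ?fset_uniq ?mem_filter ?neq_ba //=.
by rewrite asboolT.
Qed.

Lemma periodicP (T : set int) (N : nat) :
  periodic T N <->
  (0 < N)%N /\ forall n : int, `[< T (n + N%:Z) >] = `[< T n >].
Proof.
split=> [[N0 TN]|[N0 TN]]; split=> //.
  move=> n; apply: asbool_equiv_eq; split=> [|Tn].
    by rewrite -{1}TN => -[t Tt /addIr <-].
  by rewrite -TN; exists n.
apply/seteqP; split=> [_ [t /asboolP Tt <-]|t /asboolP Tt].
  by apply/asboolP; rewrite TN.
by exists (t - N%:Z); rewrite ?subrK //; apply/asboolP; rewrite -TN subrK.
Qed.

Section Averaging.
Variables (M : nat) (h : int -> nat).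
Hypothesis per_h : forall n, h (n + M%:Z) = h n.

Lemma sum_period_shift c :
  (\sum_(i < M) h (i%:Z + c)%R = \sum_(i < M) h i%:Z)%N.
Proof.
pose S c := (\sum_(i < M) h (i%:Z + c)%R)%N.
have S1 d : S (d + 1) = S d.
  rewrite /S; case: M per_h => [|m] hm; first by rewrite !big_ord0.
  rewrite big_ord_recr big_ord_recl /= addnC; congr (_ + _)%N.
    by rewrite add0r -(hm d); congr h; lia.
  by apply: eq_bigr => i _; congr h; rewrite /bump /=; lia.
rewrite -[LHS]/(S c).
suff -> : S c = S 0 by apply: eq_bigr => i _; rewrite addr0.
elim: c => // n; first by move=> <-; rewrite -[RHS]S1; congr S; lia.
by move=> <-; rewrite -[LHS]S1; congr S; lia.
Qed.
End Averaging.

(** A double count over one period, for the translates of T by the elements of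
    the dilate q * A. *)
Lemma sum_hits_period (A : {fset int}) (T : set int) (M : nat) (q : int) :
  periodic T M ->
  (\sum_(i < M) \sum_(a <- enum_fset A) `[< T (i%:Z - q * a)%R >] =
   #|` A| * \sum_(i < M) `[< T i%:Z >])%N.
Proof.
case/periodicP=> _ perT; rewrite exchange_big /=.
rewrite (eq_bigr (fun=> \sum_(i < M) `[< T i%:Z >])%N) => [|a _]; last first.
  apply: (@sum_period_shift M (fun n => `[< T n >] : nat)) => n.
  by rewrite perT.
by rewrite big_const_seq count_predT iter_addn_0 mulnC.
Qed.

Lemma tiling_card_dvd_period (A : {fset int}) (T : set int) (M : nat) :
  tiling A T -> periodic T M -> (#|` A| * \sum_(i < M) `[< T i%:Z >])%N = M.
Proof.
move=> /tilingP tAT perT; rewrite -(sum_hits_period A 1 perT).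
rewrite (eq_bigr (fun=> 1)%N) ?sum1_card ?card_ord // => i _.
by rewrite -[RHS](tAT i%:Z); apply: eq_bigr => a _; rewrite mul1r.
Qed.

(** * The polynomial of a finite set *)

Section TilePoly.
Variables (A : {fset int}) (A0 : A != fset0).

(** The mask polynomial of A, reversed and translated: the sum of the powers of
    the variable whose exponents are the distances from fset_max A to the
    elements of A.  Acting on f, it sums the values of f over a translate of
    the reflection of A. *)
Definition tilepoly (k : nzSemiRingType) : {poly k} :=
  \sum_(a <- enum_fset A) 'X^(`|fset_max A - a|%N).

Lemma distn_max a : a \in A -> `|fset_max A - a|%N%:Z = fset_max A - a.
Proof. by move=> Aa; have [_ /(_ a Aa)] := fset_maxP A0; lia. Qed.

Lemma diameter_ge0 : 0 <= diameter A.
Proof.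
have [Am _] := fset_maxP A0; have [_ /(_ _ Am)] := fset_minP A0.
by rewrite /diameter; lia.
Qed.

Lemma size_tilepoly k : (size (tilepoly k) <= `|diameter A|.+1)%N.
Proof.
apply: leq_trans (size_sum _ _ _) _; rewrite big_seq.
apply/bigmax_leqP_seq => a _ Aa; rewrite size_polyXn ltnS.
have [_ /(_ a Aa) lemin] := fset_minP A0; have := distn_max Aa.
by rewrite /diameter; lia.
Qed.

Lemma polyact_tilepoly (k : comNzRingType) (f : int -> k) n :
  polyact (tilepoly k) f n = \sum_(a <- enum_fset A) f (n + fset_max A - a).
Proof.
rewrite polyact_sum !big_seq; apply: eq_bigr => a Aa.
by rewrite polyactXn distn_max // addrA.
Qed.

Lemma tilepoly_horner1 (k : comNzRingType) : (tilepoly k).[1] = #|` A|%:R.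
Proof.
rewrite horner_sum (eq_bigr (fun=> 1)) => [|a _]; last by rewrite hornerXn expr1n.
by rewrite big_const_seq count_predT iter_addr_0.
Qed.

Lemma polyact_tilepoly_tiling (k : comNzRingType) T n : tiling A T ->
  polyact (tilepoly k) (fun m => (`[< T m >] : nat)%:R) n = 1.
Proof.
by move/tilingP=> tAT; rewrite polyact_tilepoly -natr_sum tAT.
Qed.

End TilePoly.

(** * Periodicity of tilings *)

(** A function in the kernel of the convolution by A is determined by its values
    on any window of length diameter A: in each of the convolution equations,
    the values at the two ends have coefficient 1. *)
Lemma tiling_kernel_eq0 (A : {fset int}) (g : int -> int) : A != fset0 ->
  (forall n : int, \sum_(a <- enum_fset A) g (n - a) = 0) ->
  (forall n : int, 0 <= n < diameter A -> g n = 0) -> forall n : int, g n = 0.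
Proof.
move=> A0 Ag0 win0.
have [maxA lemax] := fset_maxP A0; have [minA gemin] := fset_minP A0.
have zero_at n b : b \in A ->
    (forall a, a \in A -> a != b -> g (n - a) = 0) -> g (n - b) = 0.
  move=> Ab gb; have := Ag0 n; rewrite (bigD1_seq b) ?fset_uniq //=.
  by rewrite big_seq_cond big1 ?addr0 // => a /andP[Aa]; apply: gb.
suff grow (m : nat) (n : int) : - m%:Z <= n < diameter A + m%:Z -> g n = 0.
  by move=> n; apply: (grow `|n|.+1); have := diameter_ge0 A0; lia.
elim: m n => [|m IHm] n; first by rewrite oppr0 addr0; apply: win0.
have [n_top _|n_top] := eqVneq n (diameter A + m%:Z).
  rewrite [n](_ : _ = n + fset_min A - fset_min A); last by lia.
  apply: zero_at => // a Aa neq_a; apply: IHm.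
  by have := lemax a Aa; have := gemin a Aa; move: n_top; rewrite /diameter; lia.
have [n_bot _|n_bot] := eqVneq n (- m.+1%:Z);
  last by move=> n_in; apply: IHm; lia.
rewrite [n](_ : _ = n + fset_max A - fset_max A); last by lia.
apply: zero_at => // a Aa neq_a; apply: IHm.
by have := lemax a Aa; have := gemin a Aa; move: n_bot; rewrite /diameter; lia.
Qed.

(** Newman's theorem.  Among the first translates of the window, two show the
    same pattern of T; the difference of the two corresponding translates of the
    indicator function lies in the kernel above and vanishes on the window. *)
Lemma tiling_periodic (A : {fset int}) (T : set int) :
  A != fset0 -> tiling A T -> exists N, periodic T N.
Proof.
move=> A0 tAT; have hit1 := (tilingP A T).1 tAT.
pose D := `|diameter A|%N.
pose window (i : 'I_(#|{ffun 'I_D -> bool}|.+1)) : {ffun 'I_D -> bool} :=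
  [ffun x : 'I_D => `[< T (i%:Z + x%:Z) >]].
have /injectivePn[i0 [j0 neq_ij0 eqw0]] : ~~ injectiveb window.
  by apply/injectiveP => /leq_card; rewrite card_ord ltnn.
have [i [j [lt_ij eqw]]] : exists i j : 'I_(#|{ffun 'I_D -> bool}|.+1),
    (i < j)%N /\ window i = window j.
  case: (ltngtP i0 j0) => [lt|lt|/val_inj eq]; first by exists i0, j0.
    by exists j0, i0.
  by rewrite eq eqxx in neq_ij0.
pose g (n : int) : int :=
  (`[< T (n + j%:Z) >] : nat)%:R - (`[< T (n + i%:Z) >] : nat)%:R.
have g0 : forall n : int, g n = 0.
  apply: (tiling_kernel_eq0 A0) => n.
    rewrite /g sumrB -!natr_sum.
    suff hit c : (\sum_(a <- enum_fset A) `[< T (n - a + c)%R >] = 1)%N.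
      by rewrite !hit subrr.
    by rewrite -[RHS](hit1 (n + c)); apply: eq_bigr => a _; rewrite addrAC.
  move=> n_in; have ltnD : (`|n| < D)%N by rewrite /D; lia.
  have := congr1 (fun w : {ffun _ -> _} => w (Ordinal ltnD)) eqw.
  rewrite !ffunE /= (_ : `|n|%N%:Z = n); last by lia.
  by rewrite /g ![n + _]addrC => ->; rewrite subrr.
exists (j - i)%N; apply/periodicP; split=> [|n]; first by rewrite subn_gt0.
have /eqP := g0 (n - i%:Z); rewrite /g subrK subr_eq0 eqr_nat.
have -> : n - i%:Z + j%:Z = n + (j - i)%N%:Z by lia.
by case: `[< _ >]; case: `[< _ >].
Qed.

(** * Dilations and minimal periods *)

Lemma tilepoly_frobenius (A : {fset int}) (q : nat) : prime q ->
  tilepoly A 'F_q ^+ q = \sum_(a <- enum_fset A) 'X^(q * `|fset_max A - a|).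
Proof.
move=> q_pr; have charq : q \in [pchar {poly 'F_q}] by rewrite pchar_poly pchar_Fp.
rewrite -(pFrobenius_autE charq) rmorph_sum.
by apply: eq_bigr => a _ /=; rewrite pFrobenius_autE -exprM mulnC.
Qed.

(** Modulo q, the number of elements a of A with n - q * a in T is
    #|A| ^ (q - 1), which is nonzero. *)
Lemma tiling_dilate_hit (A : {fset int}) (T : set int) (q : nat) (n : int) :
  A != fset0 -> tiling A T -> prime q -> ~~ (q %| #|` A|)%N ->
  (0 < \sum_(a <- enum_fset A) `[< T (n - q%:Z * a)%R >])%N.
Proof.
move=> A0 tAT q_pr ndiv_q.
have charq : q \in [pchar 'F_q] by rewrite pchar_Fp.
pose f : int -> 'F_q := fun m => (`[< T m >] : nat)%:R.
have actq m : polyact (tilepoly A 'F_q ^+ q) f m = #|` A|%:R ^+ q.-1.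
  have -> : tilepoly A 'F_q ^+ q = tilepoly A 'F_q ^+ q.-1 * tilepoly A 'F_q.
    by rewrite -exprSr prednK ?prime_gt0.
  rewrite polyactM.
  rewrite (eq_polyact _ (g := fun=> 1)) => [|x]; last exact: polyact_tilepoly_tiling.
  by rewrite polyact_cst mulr1 horner_exp tilepoly_horner1.
rewrite lt0n; apply: contraNneq ndiv_q => no_hit.
rewrite (dvdn_pcharf charq).
suff : #|` A|%:R ^+ q.-1 == 0 :> 'F_q by rewrite expf_eq0 => /andP[].
rewrite -(actq (n - q%:Z * fset_max A)) tilepoly_frobenius // polyact_sum.
rewrite big_seq (eq_bigr (fun a => (`[< T (n - q%:Z * a) >] : nat)%:R)) => [|a Aa].
  by rewrite -big_seq -natr_sum no_hit.
by rewrite polyactXn /f PoszM distn_max // (_ : n - _ + _ = n - q%:Z * a) //; ring.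
Qed.

(** Tijdeman's dilation theorem for a prime dilation factor and a periodic T:
    each integer is covered at least once by the translates of T by the elements
    of q * A, and once on average over a period of T. *)
Lemma tiling_dilate (A : {fset int}) (T : set int) (M q : nat) (n : int) :
  A != fset0 -> tiling A T -> periodic T M -> prime q -> ~~ (q %| #|` A|)%N ->
  (\sum_(a <- enum_fset A) `[< T (n - q%:Z * a)%R >])%N = 1%N.
Proof.
move=> A0 tAT perT q_pr ndiv_q.
pose h (x : int) := (\sum_(a <- enum_fset A) `[< T (x - q%:Z * a)%R >])%N.
have h_gt0 x : (0 < h x)%N by apply: tiling_dilate_hit.
have [M0 perTb] := (periodicP T M).1 perT.
have per_h x : h (x + M%:Z) = h x.
  by apply: eq_bigr => a _; rewrite addrAC perTb.
have sum_h : (\sum_(i < M) h (i%:Z + n)%R = \sum_(i < M) 1)%N.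
  rewrite (sum_period_shift per_h) sum_hits_period // tiling_card_dvd_period //.
  by rewrite sum1_card card_ord.
have /eqP : (\sum_(i < M) (h (i%:Z + n)%R - 1) = 0)%N.
  by rewrite sumnB ?sum_h ?subnn // => i _; apply: h_gt0.
rewrite sum_nat_eq0 => /forallP /(_ (Ordinal M0)) /=; rewrite add0r -/(h n).
by have := h_gt0 n; lia.
Qed.

Lemma tiling_period_div (A : {fset int}) (M q : nat) :
  A != fset0 -> tiling_periods A M -> prime q -> (q %| M)%N ->
  ~~ (q %| #|` A|)%N ->
  tiling_periods A (M %/ q)%N.
Proof.
move=> A0 [T [perT tAT]] q_pr q_dvd ndiv_q.
have [M0 perTb] := (periodicP T M).1 perT.
exists [set t : int | T (q%:Z * t)]%classic; split.
  apply/periodicP; split=> [|n].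
    by rewrite divn_gt0 ?prime_gt0 // dvdn_leq.
  have -> : [set t : int | T (q%:Z * t)]%classic (n + (M %/ q)%N%:Z) =
      T (q%:Z * n + M%:Z).
    by rewrite -{2}(divnK q_dvd) /mkset mulrDr PoszM [_%:Z * q%:Z]mulrC.
  by rewrite perTb.
apply/tilingP => n.
rewrite -[RHS](tiling_dilate (q%:Z * n) A0 tAT perT q_pr ndiv_q).
by apply: eq_bigr => a _; rewrite -mulrBr.
Qed.

(** A tiling whose period is the smallest among all tilings by A. *)
Lemma same_prime_factors_min (A : {fset int}) (N : nat) :
  A != fset0 -> is_least (tiling_periods A) N ->
  exists T, [/\ tiling A T, is_least_period T N & same_prime_factors N #|` A|].
Proof.
move=> A0 [[T [perT tAT]] leN].
exists T; split=> //; first by split=> // m perm; apply: leN; exists T.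
move=> p p_pr; apply/idP/idP => [pN|pA].
  apply: contraT => pA; have perAN : tiling_periods A N by exists T.
  have := leN _ (tiling_period_div A0 perAN p_pr pN pA).
  by rewrite leqNgt ltn_Pdiv ?prime_gt1 //; case/periodicP: perT.
by rewrite -(tiling_card_dvd_period tAT perT) dvdn_mulr.
Qed.

Lemma tiles_has_period (A : {fset int}) : A != fset0 -> tiles A ->
  exists N, tiling_periods A N.
Proof.
by move=> A0 [T tAT]; have [N perT] := tiling_periodic A0 tAT; exists N, T.
Qed.
(** * The prime power parts of the least period *)

Lemma logn_dvd_not_div (p m M : nat) : prime p -> (0 < M)%N -> (p %| M)%N ->
  (m %| M)%N -> ~~ (m %| M %/ p)%N -> logn p m = logn p M.
Proof.
move=> p_pr M0 pM mM; apply: contraNeq => neq_log.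
have m0 := dvdn_gt0 M0 mM.
have Mp0 : (0 < M %/ p)%N by rewrite divn_gt0 ?prime_gt0 // dvdn_leq.
have lt_log : (logn p m < logn p M)%N by rewrite ltn_neqAle neq_log dvdn_leq_log.
apply/dvdn_partP => // q; rewrite mem_primes => /and3P[q_pr _ qm].
rewrite p_part pfactor_dvdn // logn_div // (logn_prime _ p_pr).
have := dvdn_leq_log q M0 mM; case: eqVneq => [->|_] /=; last by lia.
by lia.
Qed.

Lemma totient_lt_size_root (P : {poly rat}) (z : algC) (m : nat) : P != 0 ->
  m.-primitive_root z -> root (map_poly ratr P) z -> (totient m < size P)%N.
Proof.
move=> P0 prim_z; have [R [minR monR dvdR]] := minCpolyP z.
rewrite dvdR => /(dvdp_leq P0).
rewrite -(size_map_poly (ratr : {rmorphism rat -> algC})) -minR.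
by rewrite (minCpoly_cyclotomic prim_z) size_cyclotomic.
Qed.

Lemma leq_totient_part (p m : nat) : (0 < m)%N -> (totient m`_p <= totient m)%N.
Proof.
move=> m0; rewrite -{2}(partnC p m0) totient_coprime ?coprime_partC //.
by rewrite leq_pmulr // totient_gt0 part_gt0.
Qed.

(** The polynomial Q below is the quotient of 'X^M - 1 by 'X^N - 1, where
    N = M / p; its roots are the M-th roots of unity that are not N-th roots of
    unity. *)
Lemma tiling_common_root (A : {fset int}) (T : set int) (M p : nat) :
  A != fset0 -> tiling A T -> periodic T M -> prime p -> (p %| M)%N ->
  ~ periodic T (M %/ p)%N ->
  exists z : algC,
    [/\ root (tilepoly A algC) z, z ^+ M = 1 & z ^+ (M %/ p)%N != 1].
Proof.
move=> A0 tAT perT p_pr pM nper; set N := (M %/ p)%N.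
have [M0 perTb] := (periodicP T M).1 perT.
have N0 : (0 < N)%N by rewrite divn_gt0 ?prime_gt0 // dvdn_leq.
pose f : int -> algC := fun n => (`[< T n >] : nat)%:R.
pose g := polyact ('X^N - 1) f.
pose Q : {poly algC} := \sum_(i < p) ('X^N) ^+ i.
have QN : Q * ('X^N - 1) = 'X^M - 1 by rewrite mulrC -subrX1 -exprM divnK.
have Ag0 n : polyact (tilepoly A algC) g n = 0.
  rewrite -polyactM mulrC polyactM.
  rewrite (eq_polyact _ (g := fun=> 1)) => [|x]; last exact: polyact_tilepoly_tiling.
  by rewrite polyact_cst mulr1 !hornerE expr1n subrr.
have Qg0 n : polyact Q g n = 0.
  by rewrite -polyactM QN polyactXnB1 /f perTb subrr.
have [cop|] := boolP (coprimep (tilepoly A algC) Q).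
  case: nper; apply/periodicP; split=> // n.
  have [[u v] /= uv1] := Bezout_eq1_coprimepP _ _ cop.
  have : g n = 0.
    rewrite -[LHS]polyact1 -uv1 polyactD !polyactM.
    rewrite (eq_polyact _ (g := fun=> 0) Ag0) (eq_polyact _ (g := fun=> 0) Qg0).
    by rewrite !polyact_cst !mulr0 addr0.
  rewrite /g polyactXnB1 => /eqP; rewrite subr_eq0 eqr_nat.
  by case: `[< _ >]; case: `[< _ >].
rewrite /coprimep => /closed_rootP[z]; rewrite root_gcd => /andP[rootA rootQ].
exists z; split=> //.
  apply/eqP; rewrite -subr_eq0; have := congr1 (horner^~ z) QN.
  by rewrite hornerM (eqP rootQ) mul0r !hornerE => <-.
apply: contraTneq rootQ => zN1; rewrite /root horner_sum.
rewrite (eq_bigr (fun=> 1)) => [|i _]; last by rewrite !hornerE zN1 expr1n.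
by rewrite sumr_const card_ord pnatr_eq0 -lt0n prime_gt0.
Qed.

Lemma tilepoly_neq0 (A : {fset int}) : A != fset0 -> tilepoly A rat != 0.
Proof.
move=> A0; apply/eqP => tp0; have := tilepoly_horner1 A rat.
by move/esym/eqP; rewrite tp0 horner0 pnatr_eq0 cardfs_eq0 (negbTE A0).
Qed.

Lemma period_prime_part_leq (A : {fset int}) (T : set int) (M p : nat) :
  A != fset0 -> tiling A T -> is_least_period T M -> prime p -> (p %| M)%N ->
  (p ^ logn p M <= 2 * `|diameter A|)%N.
Proof.
move=> A0 tAT [perT leM] p_pr pM; have [M0 _] := perT.
have nper : ~ periodic T (M %/ p)%N.
  by move/leM; rewrite leqNgt ltn_Pdiv ?prime_gt1.
have [z [rootA zM zN]] := tiling_common_root A0 tAT perT p_pr pM nper.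
have [m prim_z mM] := prim_order_exists M0 zM.
have log_m : logn p m = logn p M.
  by apply: logn_dvd_not_div; rewrite // (prim_order_dvd prim_z).
have lt_m : (totient m < size (tilepoly A rat))%N.
  apply: (totient_lt_size_root (tilepoly_neq0 A0) prim_z).
  rewrite rmorph_sum; rewrite /tilepoly in rootA.
  by under eq_bigr => a _ do rewrite /= map_polyXn.
have := leq_totient_part p (prim_order_gt0 prim_z).
have a0 : (0 < logn p M)%N by rewrite logn_gt0 mem_primes p_pr M0.
rewrite p_part log_m totient_pfactor // => le_m.
have := leq_trans lt_m (size_tilepoly A0 _); rewrite ltnS.
have -> : (p ^ logn p M = p * p ^ (logn p M).-1)%N by rewrite -expnS prednK.
have : (p <= 2 * p.-1)%N by have := prime_gt1 p_pr; lia.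
by move: le_m; set x := (p ^ _)%N; set t := totient m; nia.
Qed.

(** * The number of prime divisors *)

Lemma leq_prod_primes (n : nat) : (0 < n)%N -> (\prod_(p <- primes n) p <= n)%N.
Proof.
move=> n0; rewrite {2}(prod_prime_decomp n0) prime_decompE big_map /= !big_seq.
apply: leq_prod => p; rewrite mem_primes => /and3P[p_pr _ pn].
rewrite dvdn_leq ?expn_gt0 ?prime_gt0 // dvdn_exp //.
by rewrite logn_gt0 mem_primes p_pr n0.
Qed.

(** The i-th element of an increasing sequence of positive integers is at least
    i. *)
Lemma fact_size_sorted_leq (s : seq nat) :
  sorted ltn s -> {in s, forall x, 0 < x}%N ->
  ((size s)`! <= \prod_(x <- s) x)%N.
Proof.
elim/last_ind: s => [|s x IHs]; first by rewrite big_nil.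
rewrite size_rcons factS -cats1 big_cat big_seq1 /= cats1 => sorted_sx pos.
have := sorted_sx; rewrite mulnC (sorted_pairwise ltn_trans) pairwise_rcons.
case/andP=> /allP lt_x.
rewrite -(sorted_pairwise ltn_trans) => sorted_s.
apply: leq_mul.
  by apply: IHs => // y ys; apply: pos; rewrite mem_rcons inE ys orbT.
(* The elements of rcons s x are distinct and lie between 1 and x. *)
rewrite -(size_rcons s x) -[leqRHS](size_iota 1).
apply: uniq_leq_size; first exact: (sorted_uniq ltn_trans ltnn sorted_sx).
move=> y ysx; rewrite mem_iota pos //=.
move: ysx; rewrite mem_rcons inE add1n ltnS.
by case/predU1P=> [->|/lt_x /ltnW].
Qed.

Lemma fact_size_primes_leq (n : nat) : (0 < n)%N -> ((size (primes n))`! <= n)%N.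
Proof.
move=> n0; apply: leq_trans (leq_prod_primes n0).
apply: fact_size_sorted_leq; first exact: sorted_primes.
by move=> p; rewrite mem_primes => /andP[/prime_gt0].
Qed.

Lemma exp2_size_primes_leq (n : nat) : (0 < n)%N -> (2 ^ size (primes n) <= n)%N.
Proof.
move=> n0; apply: leq_trans (leq_prod_primes n0).
have -> : (2 ^ size (primes n) = \prod_(p <- primes n) 2)%N.
  by rewrite big_const_seq count_predT iter_muln_1.
rewrite big_seq [leqRHS]big_seq; apply: leq_prod => p.
by rewrite mem_primes => /andP[/prime_gt1].
Qed.

Lemma prime_parts_leq (M B : nat) : (0 < M)%N ->
  (forall p, prime p -> (p %| M)%N -> (p ^ logn p M <= B)%N) ->
  (M <= B ^ size (primes M))%N.
Proof.
move=> M0 leB; rewrite {1}(prod_prime_decomp M0) prime_decompE big_map /=.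
have -> : (B ^ size (primes M) = \prod_(p <- primes M) B)%N.
  by rewrite big_const_seq count_predT iter_muln_1.
rewrite big_seq [leqRHS]big_seq; apply: leq_prod => p.
by rewrite mem_primes => /and3P[p_pr _ pM]; apply: leB.
Qed.

Lemma card_leq_diameter (A : {fset int}) : A != fset0 ->
  (#|` A| <= `|diameter A|.+1)%N.
Proof.
move=> A0; have [maxA lemax] := fset_maxP A0; have [minA gemin] := fset_minP A0.
have inj : {in A &, injective (fun a => `|a - fset_min A|%N)}.
  by move=> a b /gemin la /gemin lb /=; lia.
rewrite -(size_map (fun a => `|a - fset_min A|%N)) -[X in (_ <= X)%N](size_iota 0).
apply: uniq_leq_size; first by rewrite map_inj_in_uniq ?fset_uniq.
move=> _ /mapP[a Aa ->]; rewrite mem_iota /diameter.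
by have := lemax a Aa; have := gemin a Aa; lia.
Qed.

(** * Logarithmic estimates *)

Section RealBounds.
Variable R : realType.

Lemma expR1_lt3 : expR 1 < 3 :> R.
Proof.
(* The exponent 6 is the least integer n > 1 with (1 - 1 / n) ^- n < 3. *)
have h : expR (- 6^-1) >= 5 / 6 :> R.
  by apply: le_trans (expR_ge1Dx _); lra.
have h6 : (5 / 6) ^+ 6 <= expR (- 1) :> R.
  rewrite (_ : -1 = (- 6^-1) * 6%:R :> R); last by field.
  by rewrite expRM_natr lerXn2r // nnegrE ?expR_ge0 //; lra.
rewrite -(invrK (expR 1)) -expRN invf_plt ?posrE ?expR_gt0 //.
by apply: lt_le_trans h6; rewrite !exprS expr0; lra.
Qed.

(** Hence ln (ln x) is positive for x >= 3. *)
Lemma ln_gt1 (x : R) : 3 <= x -> 1 < ln x.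
Proof.
move=> x3; rewrite -(expRK 1) ltr_ln ?posrE ?expR_gt0 //; last by lra.
exact: lt_le_trans expR1_lt3 x3.
Qed.

(** The weak form k ^ k <= k! * e ^ k of Stirling's formula. *)
Lemma nat_mul_ln_le_ln_fact (k : nat) :
  k%:R * ln k%:R <= ln (k`!%:R) + k%:R :> R.
Proof.
elim: k => [|k IHk]; first by rewrite mul0r addr0 fact0 ln1.
case: k IHk => [_|k IHk]; first by rewrite (_ : 1`! = 1%N) // !ln1 mulr0 add0r.
set m := k.+1 in IHk *; have m0 : 0 < m%:R :> R by rewrite ltr0n.
have f0 : 0 < (m`!)%:R :> R by rewrite ltr0n fact_gt0.
have lnS : ln (m.+1%:R) <= ln (m%:R) + m%:R^-1 :> R.
  have -> : m.+1%:R = m%:R * (1 + m%:R^-1) :> R.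
    by rewrite mulrDr mulr1 divff ?gt_eqF // -natr1.
  have i0 : 0 < m%:R^-1 :> R by rewrite invr_gt0.
  rewrite lnM ?posrE //; last by lra.
  by rewrite lerD2l le_ln1Dx //; lra.
rewrite factS natrM lnM ?posrE ?ltr0n ?fact_gt0 //.
have : m%:R * ln (m.+1%:R) <= m%:R * ln m%:R + 1 :> R.
  by move: lnS; rewrite -(ler_pM2l m0) mulrDr divff ?lt0r_neq0.
have -> : m.+1%:R * ln m.+1%:R = m%:R * ln m.+1%:R + ln m.+1%:R :> R.
  by rewrite -{1}(natr1 (R := R) m) mulrDl mul1r.
by have := natr1 (R := R) m; move: IHk; lra.
Qed.

(** If k! and 2 ^ k are at most x ^ 2, then k is O(ln x / ln (ln x)). *)
Lemma size_mul_lnln_le (k n : nat) (x : R) :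
  (k`! <= n)%N -> (2 ^ k <= n)%N -> n%:R <= x ^+ 2 -> 3 <= x ->
  k%:R * ln (ln x) <= 9 * ln x.
Proof.
move=> fact_le exp2_le n_le x3; have L1 := ln_gt1 x3; have x0 : 0 < x by lra.
have [->|k0] := posnP k; first by rewrite mul0r; lra.
have kR0 : 0 < k%:R :> R by rewrite ltr0n.
have ln_n (m : nat) : (0 < m)%N -> (m <= n)%N -> ln m%:R <= 2 * ln x.
  move=> m0 le_mn; rewrite mulr_natl -lnXn // ler_ln ?posrE ?ltr0n ?exprn_gt0 //.
  by apply: le_trans n_le; rewrite ler_nat.
have ln2 : 3^-1 <= ln 2 :> R.
  have : ln (1 + - 2^-1) <= - 2^-1 :> R by apply: le_ln1Dx; lra.
  rewrite (_ : 1 + - 2^-1 = 2^-1 :> R); last by field.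
  by rewrite lnV ?posrE // lerN2 => ln2; apply: le_trans _ ln2; lra.
have k_le : k%:R <= 6 * ln x.
  have := ln_n _ (expn_gt0 2 k) exp2_le; rewrite natrX lnXn // -(mulr_natr (ln _)).
  have : 3^-1 * k%:R <= ln 2 * k%:R :> R by rewrite ler_pM2r.
  by lra.
have fact_ln := ln_n _ (fact_gt0 k) fact_le.
have klnk := nat_mul_ln_le_ln_fact k.
(* Splitting ln x as k * (ln x / k) and using ln y < y reduces the claim to a
   bound on k * ln k. *)
have lnln : ln (ln x) <= ln k%:R + ln x / k%:R.
  rewrite -{1}(divfK (lt0r_neq0 kR0) (ln x)) lnM ?posrE ?divr_gt0 //; last by lra.
  by rewrite addrC lerD2l ltW // ln_sublinear // divr_gt0 //; lra.
have : k%:R * ln (ln x) <= k%:R * ln k%:R + ln x.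
  rewrite -[X in _ <= _ + X](divfK (lt0r_neq0 kR0) (ln x)).
  by rewrite [X in _ + X]mulrC -mulrDr ler_pM2l.
by move: L1 k_le fact_ln klnk; lra.
Qed.

Lemma le_exp_ln_sqr_div_lnln (k n M : nat) (x : R) :
  (k`! <= n)%N -> (2 ^ k <= n)%N -> n%:R <= x + 1 -> 3 <= x ->
  M%:R <= (2 * x) ^+ k -> M%:R <= expR (18 * (ln x ^+ 2 / ln (ln x))).
Proof.
move=> fact_le exp2_le n_le x3 M_le; have L1 := ln_gt1 x3; have x0 : 0 < x by lra.
have ell0 : 0 < ln (ln x) by apply: ln_gt0.
apply: le_trans M_le _.
have le1 : (2 * x) ^+ k <= expR (2 * k%:R * ln x).
  rewrite (_ : 2 * k%:R * ln x = k%:R * (2%:R * ln x)); last by ring.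
  by rewrite !expRM_natl lnK ?posrE // lerXn2r ?nnegrE //; nra.
apply: le_trans le1 _; rewrite ler_expR mulrA ler_pdivlMr //.
have := size_mul_lnln_le fact_le exp2_le (le_trans n_le _) x3.
have x2 : x + 1 <= x ^+ 2 by nra.
by move=> /(_ x2); nra.
Qed.
End RealBounds.

Theorem theorem1 (R : realType) :
  (exists c : R, 0 < c /\
    forall (A : {fset int}) (T : set int) (M : nat),
      A != fset0 -> tiling A T -> is_least_period T M ->
      same_prime_factors M #|` A| ->
      (min_tiling_period A <= M)%N /\
      (3 <= diameter A ->
       M%:R <= expR (c * (ln ((diameter A)%:~R : R) ^+ 2
                          / ln (ln ((diameter A)%:~R : R)))))) /\
  (forall A : {fset int}, A != fset0 -> tiles A ->
    exists (T : set int) (M : nat),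
      [/\ tiling A T, is_least_period T M & same_prime_factors M #|` A|]).
Proof.
split=> [|A A0 tA]; last first.
  have [N minN] := ex_intro (is_least (tiling_periods A)) _
    (min_tiling_periodP (tiles_has_period A0 tA)).
  by have [T tT] := same_prime_factors_min A0 minN; exists T, N.
exists 18; split=> // A T M A0 tAT perM same_pf; have [perT _] := perM.
have perAM : tiling_periods A M by exists T.
split=> [|D3]; first by have [_ ->] := min_tiling_periodP (ex_intro _ M perAM).
have [M0 _] := perT; have cardA0 : (0 < #|` A|)%N by rewrite cardfs_gt0.
have prM : primes M = primes #|` A|.
  apply/eq_primes => p; rewrite !mem_primes M0 cardA0 /=.
  by case p_pr: (prime p) => //=; apply: same_pf.
have absD : (`|diameter A|%N)%:R = (diameter A)%:~R :> R.
  by rewrite pmulrn gtz0_abs //; lia.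
apply: (le_exp_ln_sqr_div_lnln (fact_size_primes_leq cardA0)).
- exact: exp2_size_primes_leq.
- by rewrite -absD natr1 ler_nat card_leq_diameter.
- by rewrite (_ : 3 = 3%:~R) // ler_int.
rewrite -absD -prM -natrM -natrX ler_nat; apply: prime_parts_leq => // p p_pr pM.
exact: period_prime_part_leq perM p_pr pM.
Qed.
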